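(* Let $\mathcal{B}$ be a triangulated category with shift functor $[1]$. Then there exists a one-to-one correspondence between weakly projective model structures on $\mathcal{B}$ and co-$t$-structures $(\mathcal{X},\mathcal{Y})$ on $\mathcal{B}$ (where $\mathcal{X}$ and $\mathcal{Y}$ are full additive subcategories of $\mathcal{B}$ closed under direct summands and isomorphisms) whose coheart $\mathcal{X}\cap\mathcal{Y}$ is contravariantly finite in $\mathcal{B}$.
   Context: For a distinguished triangle $A\xrightarrow{x}B\xrightarrow{y}C\to A[1]$, the cone of $x$ is $C$ and the cocone of $y$ is $A$. (A triangulated category is viewed as an extriangulated category with $\mathbb{E}(C,A)=\mathcal{B}(C,A[1])$, so every morphism is both an inflation and a deflation.) A co-$t$-structure on $\mathcal{B}$ is a pair $(\mathcal{X},\mathcal{Y})$ of full subcategories (closed under isomorphisms and direct summands) such that (1) $\mathcal{X}[-1]\subseteq\mathcal{X}$ and $\mathcal{Y}[1]\subseteq\mathcal{Y}$; (2) $\mathrm{Hom}_{\mathcal{B}}(\mathcal{X}[-1],\mathcal{Y})=0$; (3) every $T\in\mathcal{B}$ has a distinguished triangle $X\to T\to Y\to X[1]$ with $X\in\mathcal{X}[-1]$ and $Y\in\mathcal{Y}$. Its coheart is $\mathcal{X}\cap\mathcal{Y}$. A full subcategory $\omega$ is contravariantly finite in $\mathcal{B}$ if every $B\in\mathcal{B}$ has a morphism $t:W\to B$ with $W\in\omega$ through which every morphism $W'\to B$ with $W'\in\omega$ factors. A model structure on a category is a triple $(\mathrm{CoFib},\mathrm{Fib},\mathrm{Weq})$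 of classes of morphisms (cofibrations, fibrations, weak equivalences) satisfying: the two-out-of-three axiom for $\mathrm{Weq}$; closure of each class under retracts; lifting ($\mathrm{CoFib}$ has the left lifting property against $\mathrm{Fib}\cap\mathrm{Weq}$, and $\mathrm{CoFib}\cap\mathrm{Weq}$ against $\mathrm{Fib}$); factorization (each morphism can be written as $pi$ with $i\in\mathrm{CoFib}\cap\mathrm{Weq}$, $p\in\mathrm{Fib}$, and as $qj$ with $j\in\mathrm{CoFib}$, $q\in\mathrm{Fib}\cap\mathrm{Weq}$). No existence of limits or colimits is required. An object $X$ is cofibrant if $0\to X\in\mathrm{CoFib}$, fibrant if $X\to 0\in\mathrm{Fib}$, trivial if $0\to X\in\mathrm{Weq}$, and trivially fibrant if it is trivial and fibrant. A model structure on a triangulated category $\mathcal{B}$ is weakly projective if cofibrations are precisely the morphisms with cofibrant cone, trivial fibrations (morphisms in $\mathrm{Fib}\cap\mathrm{Weq}$) are precisely the morphisms with trivially fibrant cocone, and each object is fibrant. *)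

(* Defs.v *)
From mathcomp Require Import all_boot all_algebra.

Set Implicit Arguments.
Unset Strict Implicit.
Unset Printing Implicit Defensive.

Import GRing.Theory.

Local Open Scope ring_scope.

Reserved Notation "g \oc f" (at level 40, left associativity).

(** * Additive categories *)

Record preadditive_category := PreadditiveCategory {
  obj :> Type;
  hom : obj -> obj -> zmodType;
  idm : forall A, hom A A;
  comp : forall A B C, hom B C -> hom A B -> hom A C;
  comp1m : forall A B (f : hom A B), comp (idm B) f = f;
  compm1 : forall A B (f : hom A B), comp f (idm A) = f;
  compA : forall A B C D (h : hom C D) (g : hom B C) (f : hom A B),
    comp h (comp g f) = comp (comp h g) f;
  compDl : forall A B C (g g' : hom B C) (f : hom A B),
    comp (g + g') f = comp g f + comp g' f;
  compDr : forall A B C (g : hom B C) (f f' : hom A B),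
    comp g (f + f') = comp g f + comp g f'
}.

Arguments hom {_} _ _.
Arguments idm {_} _.

Notation "g \oc f" := (comp g f).

Definition inverse_morphisms (C : preadditive_category) (A B : C)
    (f : hom A B) (g : hom B A) : Prop :=
  g \oc f = idm A /\ f \oc g = idm B.

Definition is_iso (C : preadditive_category) (A B : C) (f : hom A B) : Prop :=
  exists g : hom B A, inverse_morphisms f g.

Definition isomorphic (C : preadditive_category) (A B : C) : Prop :=
  exists f : hom A B, is_iso f.

(** [S] is a direct sum of [A] and [B]. *)
Definition is_biproduct (C : preadditive_category) (A B S : C) : Prop :=
  exists (i1 : hom A S) (i2 : hom B S) (p1 : hom S A) (p2 : hom S B),
    [/\ p1 \oc i1 = idm A, p2 \oc i2 = idm B, p2 \oc i1 = 0, p1 \oc i2 = 0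
      & i1 \oc p1 + i2 \oc p2 = idm S].

(** In a preadditive category, an object is a zero object if and only if its
    identity is zero; the morphisms to and from it are then the zero ones. *)
Record additive_category := AdditiveCategory {
  add_preadditive :> preadditive_category;
  zobj : add_preadditive;
  zobj_id : idm zobj = 0;
  biproduct_exists : forall A B : add_preadditive,
    exists S, is_biproduct A B S
}.

Arguments zobj {_}.

Record additive_functor (C D : preadditive_category) := AdditiveFunctor {
  fobj :> C -> D;
  fmap : forall A B : C, hom A B -> hom (fobj A) (fobj B);
  fmap_id : forall A, fmap (idm A) = idm (fobj A);
  fmap_comp : forall (A B E : C) (g : hom B E) (f : hom A B),
    fmap (g \oc f) = fmap g \oc fmap f;
  fmap_add : forall (A B : C) (f g : hom A B),
    fmap (f + g) = fmap f + fmap g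
}.

(** * Triangulated categories *)

(** The shift is an additive auto-equivalence, not necessarily a strict
    automorphism: it comes with a quasi-inverse [unshift]. *)
Record autoequivalence (C : preadditive_category) := Autoequivalence {
  shift : additive_functor C C;
  unshift : additive_functor C C;
  shift_unit : forall A : C, hom A (unshift (shift A));
  shift_unit_iso : forall A, is_iso (shift_unit A);
  shift_unit_nat : forall (A B : C) (f : hom A B),
    fmap unshift (fmap shift f) \oc shift_unit A = shift_unit B \oc f;
  shift_counit : forall A : C, hom (shift (unshift A)) A;
  shift_counit_iso : forall A, is_iso (shift_counit A);
  shift_counit_nat : forall (A B : C) (f : hom A B),
    f \oc shift_counit A = shift_counit B \oc fmap shift (fmap unshift f)
}.

Record triangulated_category := TriangulatedCategory {
  tri_additive :> additive_category;
  tri_shift : autoequivalence tri_additive;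
  (* [dist u v w]: the triangle A -u-> B -v-> C -w-> A[1] is distinguished. *)
  dist : forall A B C : tri_additive,
    hom A B -> hom B C -> hom C (shift tri_shift A) -> Prop;
  (* TR1 *)
  dist_iso : forall (A B C A' B' C' : tri_additive)
      (u : hom A B) (v : hom B C) (w : hom C (shift tri_shift A))
      (u' : hom A' B') (v' : hom B' C') (w' : hom C' (shift tri_shift A'))
      (a : hom A A') (b : hom B B') (c : hom C C'),
    is_iso a -> is_iso b -> is_iso c ->
    b \oc u = u' \oc a -> c \oc v = v' \oc b ->
    fmap (shift tri_shift) a \oc w = w' \oc c ->
    dist u v w -> dist u' v' w';
  dist_id : forall A : tri_additive,
    dist (idm A) (0 : hom A zobj) (0 : hom zobj (shift tri_shift A));
  dist_exists : forall (A B : tri_additive) (u : hom A B),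
    exists (C : tri_additive) (v : hom B C) (w : hom C (shift tri_shift A)),
      dist u v w;
  (* TR2 *)
  dist_rotate : forall (A B C : tri_additive)
      (u : hom A B) (v : hom B C) (w : hom C (shift tri_shift A)),
    dist u v w <-> dist v w (- fmap (shift tri_shift) u);
  (* TR3 *)
  dist_morphism : forall (A B C A' B' C' : tri_additive)
      (u : hom A B) (v : hom B C) (w : hom C (shift tri_shift A))
      (u' : hom A' B') (v' : hom B' C') (w' : hom C' (shift tri_shift A'))
      (a : hom A A') (b : hom B B'),
    dist u v w -> dist u' v' w' -> b \oc u = u' \oc a ->
    exists c : hom C C',
      c \oc v = v' \oc b /\ fmap (shift tri_shift) a \oc w = w' \oc c;
  (* TR4, the octahedral axiom *)
  dist_octahedron : forall (X Y Z P Q R : tri_additive)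
      (u : hom X Y) (v : hom Y Z)
      (a : hom Y P) (d : hom P (shift tri_shift X))
      (b : hom Z Q) (d' : hom Q (shift tri_shift X))
      (c : hom Z R) (d'' : hom R (shift tri_shift Y)),
    dist u a d -> dist (v \oc u) b d' -> dist v c d'' ->
    exists (f : hom P Q) (g : hom Q R),
      [/\ dist f g (fmap (shift tri_shift) a \oc d''),
          f \oc a = b \oc v, d' \oc f = d,
          g \oc b = c & d'' \oc g = fmap (shift tri_shift) u \oc d']
}.

Definition has_cone_in (B : triangulated_category) (P : B -> Prop)
    (A A' : B) (x : hom A A') : Prop :=
  exists (C : B) (y : hom A' C) (z : hom C (shift (tri_shift B) A)),
    dist x y z /\ P C.

Definition has_cocone_in (B : triangulated_category) (P : B -> Prop)
    (A A' : B) (y : hom A A') : Prop :=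
  exists (K : B) (x : hom K A) (z : hom A' (shift (tri_shift B) K)),
    dist x y z /\ P K.

(** * Full subcategories, given by predicates on objects *)

Definition iso_closed (C : preadditive_category) (P : C -> Prop) : Prop :=
  forall A B : C, isomorphic A B -> P A -> P B.

Definition summand_closed (C : preadditive_category) (P : C -> Prop) : Prop :=
  forall A A' S : C, is_biproduct A A' S -> P S -> P A.

Definition additive_subcategory (C : additive_category) (P : C -> Prop) : Prop :=
  P zobj /\ forall A B S : C, is_biproduct A B S -> P A -> P B -> P S.

Definition contravariantly_finite (C : preadditive_category)
    (P : C -> Prop) : Prop :=
  forall B : C, exists (W : C) (t : hom W B),
    P W /\ forall (W' : C) (t' : hom W' B), P W' ->
      exists s : hom W' W, t' = t \oc s.

(** [image_subcategory F P] is the full subcategory F(P), closed under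
    isomorphisms; it is written P[1], resp. P[-1], for the shift, resp. its
    quasi-inverse. *)
Definition image_subcategory (C D : preadditive_category)
    (F : additive_functor C D) (P : C -> Prop) : D -> Prop :=
  fun Z => exists A : C, P A /\ isomorphic Z (F A).

Record cot_axioms (B : triangulated_category) (X Y : B -> Prop) : Prop :=
  CotAxioms {
  cotX_additive : additive_subcategory X;
  cotX_iso : iso_closed X;
  cotX_summand : summand_closed X;
  cotY_additive : additive_subcategory Y;
  cotY_iso : iso_closed Y;
  cotY_summand : summand_closed Y;
  cotX_unshift : forall A : B,
    image_subcategory (unshift (tri_shift B)) X A -> X A;
  cotY_shift : forall A : B,
    image_subcategory (shift (tri_shift B)) Y A -> Y A;
  cot_orthogonal : forall (A A' : B) (f : hom A A'),
    image_subcategory (unshift (tri_shift B)) X A -> Y A' -> f = 0;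
  cot_triangle : forall T : B,
    exists (A A' : B) (x : hom A T) (y : hom T A')
           (z : hom A' (shift (tri_shift B) A)),
      [/\ dist x y z, image_subcategory (unshift (tri_shift B)) X A & Y A']
}.

Record cot_structure (B : triangulated_category) := CotStructure {
  cotX : B -> Prop;
  cotY : B -> Prop;
  cot_is_cot : cot_axioms cotX cotY
}.

Definition coheart (B : triangulated_category) (T : cot_structure B) :
    B -> Prop :=
  fun A => cotX T A /\ cotY T A.

(** * Model structures *)

Definition morphism_class (C : preadditive_category) : Type :=
  forall A B : C, hom A B -> Prop.

Definition trivial_class (C : preadditive_category)
    (M N : morphism_class C) : morphism_class C :=
  fun A B f => M A B f /\ N A B f.

Definition two_out_of_three (C : preadditive_category)
    (M : morphism_class C) : Prop :=
  forall (A B D : C) (f : hom A B) (g : hom B D),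
    [/\ M _ _ f -> M _ _ g -> M _ _ (g \oc f),
        M _ _ f -> M _ _ (g \oc f) -> M _ _ g
      & M _ _ g -> M _ _ (g \oc f) -> M _ _ f].

Definition is_retract (C : preadditive_category) (A B A' B' : C)
    (f : hom A B) (g : hom A' B') : Prop :=
  exists (i : hom A A') (r : hom A' A) (j : hom B B') (s : hom B' B),
    [/\ r \oc i = idm A, s \oc j = idm B,
        j \oc f = g \oc i & s \oc g = f \oc r].

Definition retract_closed (C : preadditive_category)
    (M : morphism_class C) : Prop :=
  forall (A B A' B' : C) (f : hom A B) (g : hom A' B'),
    is_retract f g -> M _ _ g -> M _ _ f.

Definition lifts_against (C : preadditive_category)
    (M N : morphism_class C) : Prop :=
  forall (A B X Y : C) (i : hom A B) (p : hom X Y)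
         (a : hom A X) (b : hom B Y),
    M _ _ i -> N _ _ p -> p \oc a = b \oc i ->
    exists h : hom B X, h \oc i = a /\ p \oc h = b.

Definition factorizes_as (C : preadditive_category)
    (M N : morphism_class C) : Prop :=
  forall (A B : C) (f : hom A B),
    exists (E : C) (i : hom A E) (p : hom E B),
      [/\ M _ _ i, N _ _ p & f = p \oc i].

Record model_axioms (C : preadditive_category)
    (cof fib weq : morphism_class C) : Prop := ModelAxioms {
  model_two_out_of_three : two_out_of_three weq;
  model_cofib_retract : retract_closed cof;
  model_fib_retract : retract_closed fib;
  model_weq_retract : retract_closed weq;
  model_cofib_lift : lifts_against cof (trivial_class fib weq);
  model_fib_lift : lifts_against (trivial_class cof weq) fib;
  model_trivcofib_fib : factorizes_as (trivial_class cof weq) fib;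
  model_cofib_trivfib : factorizes_as cof (trivial_class fib weq)
}.

Record model_structure (C : preadditive_category) := ModelStructure {
  Cofib : morphism_class C;
  Fib : morphism_class C;
  Weq : morphism_class C;
  model_is_model : model_axioms Cofib Fib Weq
}.

Section ModelObjects.

Variables (C : additive_category) (M : model_structure C).

Definition cofibrant (A : C) : Prop := Cofib M (0 : hom zobj A).
Definition fibrant (A : C) : Prop := Fib M (0 : hom A zobj).
Definition trivial (A : C) : Prop := Weq M (0 : hom zobj A).
Definition trivially_fibrant (A : C) : Prop := trivial A /\ fibrant A.

End ModelObjects.

Record weakly_projective (B : triangulated_category)
    (M : model_structure B) : Prop := WeaklyProjective {
  wp_cofib : forall (A A' : B) (f : hom A A'),
    Cofib M f <-> has_cone_in (cofibrant M) f;
  wp_trivfib : forall (A A' : B) (f : hom A A'),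
    (Fib M f /\ Weq M f) <-> has_cocone_in (trivially_fibrant M) f;
  wp_fibrant : forall A : B, fibrant M A
}.

(* Main.v *)
From mathcomp Require Import all_boot all_algebra.
From mathcomp Require Import boolp.
Require Import Defs.

(* A weakly projective model structure M gives X = cofibrant objects and
   Y = trivially fibrant objects; the axioms of a co-t-structure come from
   factoring 0 -> T and T -> 0.  Conversely, given (X, Y) with coheart H
   contravariantly finite, cofibrations are the maps with cone in X, fibrations
   are the f with Hom(W, f) onto for W in H, and weak equivalences are the f
   such that Hom(E, f) is bijective modulo maps through H for all E in X; the
   last choice makes two-out-of-three and retract closure formal.  The two
   constructions are inverse because M is determined by X and Y: every object
   being fibrant, the trivial cofibrations of M are the split monomorphisms with
   cone in H, so its fibrations are the maps above, and the weak equivalences of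
   a model structure are determined by its cofibrations and fibrations. *)

Set Implicit Arguments.
Unset Strict Implicit.
Unset Printing Implicit Defensive.

Import GRing.Theory.
Local Open Scope ring_scope.

(** * Preadditive categories *)

Section Preadditive.

Variable C : preadditive_category.
Implicit Types A B D : C.

Lemma comp0m A B D (f : hom A B) : (0 : hom B D) \oc f = 0.
Proof. by apply: (addrI ((0 : hom B D) \oc f)); rewrite -compDl !addr0. Qed.

Lemma compm0 A B D (g : hom B D) : g \oc (0 : hom A B) = 0.
Proof. by apply: (addrI (g \oc (0 : hom A B))); rewrite -compDr !addr0. Qed.

Lemma compNm A B D (g : hom B D) (f : hom A B) : (- g) \oc f = - (g \oc f).
Proof. by apply: (addrI (g \oc f)); rewrite -compDl !subrr comp0m. Qed.

Lemma compmN A B D (g : hom B D) (f : hom A B) : g \oc (- f) = - (g \oc f).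
Proof. by apply: (addrI (g \oc f)); rewrite -compDr !subrr compm0. Qed.

Lemma compBl A B D (g g' : hom B D) (f : hom A B) :
  (g - g') \oc f = g \oc f - g' \oc f.
Proof. by rewrite compDl compNm. Qed.

Lemma compBr A B D (g : hom B D) (f f' : hom A B) :
  g \oc (f - f') = g \oc f - g \oc f'.
Proof. by rewrite compDr compmN. Qed.

Lemma is_iso_id A : is_iso (idm A).
Proof. by exists (idm A); split; rewrite comp1m. Qed.

Lemma inverse_is_iso A B (f : hom A B) (g : hom B A) :
  inverse_morphisms f g -> is_iso g.
Proof. by case=> gf fg; exists f. Qed.

Lemma iso_sym A B : isomorphic A B -> isomorphic B A.
Proof. by move=> [f [g fg]]; exists g; apply: inverse_is_iso fg. Qed.

Lemma iso_trans A B D : isomorphic A B -> isomorphic B D -> isomorphic A D.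
Proof.
move=> [f [f' [f'f ff']]] [g [g' [g'g gg']]]; exists (g \oc f), (f' \oc g').
split; first by rewrite -compA (compA g') g'g comp1m.
by rewrite -compA (compA f) ff' comp1m.
Qed.

Lemma iso_is_retract A B :
  isomorphic A B -> exists (i : hom A B) (r : hom B A), r \oc i = idm A.
Proof. by move=> [f [g [gf _]]]; exists f, g. Qed.

Lemma biproduct_is_retract A B S : is_biproduct A B S ->
  exists (i : hom A S) (r : hom S A), r \oc i = idm A.
Proof. by move=> [i [_ [r [_ [ri _ _ _ _]]]]]; exists i, r. Qed.

Lemma fmap0 (D : preadditive_category) (F : additive_functor C D) A B :
  fmap F (0 : hom A B) = 0.
Proof. by apply: (addrI (fmap F (0 : hom A B))); rewrite -fmap_add !addr0. Qed.

Lemma fmapN (D : preadditive_category) (F : additive_functor C D) A B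
  (f : hom A B) : fmap F (- f) = - fmap F f.
Proof. by apply: (addrI (fmap F f)); rewrite -fmap_add !subrr fmap0. Qed.

Lemma fmap_isomorphic (D : preadditive_category) (F : additive_functor C D)
  A B : isomorphic A B -> isomorphic (F A) (F B).
Proof.
move=> [f [g [gf fg]]]; exists (fmap F f), (fmap F g).
by split; rewrite -fmap_comp ?gf ?fg fmap_id.
Qed.

End Preadditive.

Lemma hom_from_zobj (C : additive_category) (A : C) (f : hom zobj A) : f = 0.
Proof. by rewrite -[f]compm1 zobj_id compm0. Qed.

Lemma hom_to_zobj (C : additive_category) (A : C) (f : hom A zobj) : f = 0.
Proof. by rewrite -[f]comp1m zobj_id comp0m. Qed.

(** * Fullness and faithfulness of the shift *)

Section Autoequivalence.

Variables (C : preadditive_category) (T : autoequivalence C).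
Implicit Types A B : C.

Lemma unshift_faithful A B (f : hom A B) : fmap (unshift T) f = 0 -> f = 0.
Proof.
move=> f0; have [e [_ eK]] := shift_counit_iso T A.
by rewrite -[f]compm1 -eK compA shift_counit_nat f0 fmap0 compm0 comp0m.
Qed.

Lemma shift_faithful A B (f : hom A B) : fmap (shift T) f = 0 -> f = 0.
Proof.
move=> f0; have [e [eK _]] := shift_unit_iso T B.
by rewrite -[f]comp1m -eK -compA -shift_unit_nat f0 fmap0 comp0m compm0.
Qed.

(** The preimage is [unshift g] conjugated by the unit; the equality is checked after applying the
    faithful [unshift]. *)
Lemma shift_full A B (g : hom (shift T A) (shift T B)) :
  exists f, g = fmap (shift T) f.
Proof.
have [e [eK Ke]] := shift_unit_iso T B.
have [d [dK Kd]] := shift_unit_iso T A.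
exists (e \oc fmap (unshift T) g \oc shift_unit T A).
apply/eqP; rewrite -subr_eq0; apply/eqP/unshift_faithful.
rewrite fmap_add fmapN; apply/eqP; rewrite subr_eq0; apply/eqP.
set f := _ \oc shift_unit T A.
rewrite -[RHS]compm1 -Kd compA shift_unit_nat /f !compA Ke comp1m.
by rewrite -compA Kd compm1.
Qed.

Lemma shift_unshift_isomorphic A : isomorphic (shift T (unshift T A)) A.
Proof. by exists (shift_counit T A); apply: shift_counit_iso. Qed.

Lemma unshift_shift_isomorphic A : isomorphic A (unshift T (shift T A)).
Proof. by exists (shift_unit T A); apply: shift_unit_iso. Qed.

(** Trades membership in [P[-1]] for [P] at the shift, the form used in the later arguments. *)
Lemma image_unshiftP (P : C -> Prop) A : iso_closed P ->
  image_subcategory (unshift T) P A <-> P (shift T A).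
Proof.
move=> isoP; split=> [[D [PD AD]] | PA].
  apply: isoP PD; apply: iso_sym.
  exact: iso_trans (fmap_isomorphic (shift T) AD) (shift_unshift_isomorphic D).
exists (shift T A); split=> //; exact: unshift_shift_isomorphic.
Qed.

End Autoequivalence.

(** * Triangulated categories *)

Notation sh := (shift (tri_shift _)).

Section Triangulated.

Variable B : triangulated_category.
Implicit Types A D E K Z : B.

Lemma dist_from_zobj A : dist (0 : hom zobj A) (idm A) (0 : hom A (sh zobj)).
Proof.
have zS : is_iso (0 : hom zobj (sh (zobj : B))).
  exists 0; split; first by rewrite comp0m zobj_id.
  by rewrite comp0m -fmap_id zobj_id fmap0.
apply/dist_rotate; rewrite fmap0 oppr0.
apply: (dist_iso (is_iso_id A) (is_iso_id A) zS _ _ _ (dist_id A));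
  by rewrite ?compm0 ?comp0m.
Qed.

Lemma dist_to_zobj Z :
  exists w : hom (sh Z) (sh Z), dist (0 : hom Z zobj) 0 w.
Proof.
exists (- fmap sh (idm Z)); exact: (proj1 (dist_rotate _ _ _) (dist_id Z)).
Qed.

(** * Long exact Hom sequences of a triangle *)

Section Exactness.

Variables (A D E : B) (u : hom A D) (v : hom D E) (w : hom E (sh A)).
Hypothesis uvw : dist u v w.

(** TR3 from the triangle [Z -> 0 -> Z[1]] to the rotation of [uvw] yields a map [Z[1] -> A[1]],
    which is the shift of the lift sought. *)
Lemma dist_lift Z (g : hom Z D) : v \oc g = 0 -> exists h, g = u \oc h.
Proof.
move=> vg0.
have tZ := proj1 (dist_rotate _ _ _) (dist_id Z).
have tu := proj1 (dist_rotate _ _ _) uvw.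
have sq : (0 : hom zobj E) \oc (0 : hom Z zobj) = v \oc g by rewrite vg0 comp0m.
have [c [_ cE]] := dist_morphism tZ tu sq.
have [h hE] := shift_full c.
exists h; apply/eqP; rewrite -subr_eq0; apply/eqP/(@shift_faithful _ (tri_shift B)).
move: cE; rewrite fmap_id compmN compm1 compNm hE => /oppr_inj gE.
by rewrite fmap_add fmapN fmap_comp gE subrr.
Qed.

Lemma dist_comp0 : v \oc u = 0.
Proof.
have sq : u \oc idm A = u \oc idm A by [].
have [c [cE _]] := dist_morphism (dist_id A) uvw sq.
by rewrite -cE compm0.
Qed.

Lemma dist_extend Z (g : hom D Z) : g \oc u = 0 -> exists h, g = h \oc v.
Proof.
move=> gu0; have tz := dist_from_zobj Z.
have sq : g \oc u = (0 : hom zobj Z) \oc (0 : hom A zobj) by rewrite gu0 comp0m.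
have [h [hE _]] := dist_morphism uvw tz sq.
by exists h; rewrite hE comp1m.
Qed.

End Exactness.

Section RotatedExactness.

Variables (A D E : B) (u : hom A D) (v : hom D E) (w : hom E (sh A)).
Hypothesis uvw : dist u v w.
Let vwu := proj1 (dist_rotate u v w) uvw.
Let wuv := proj1 (dist_rotate v w (- fmap sh u)) vwu.

Lemma dist_comp0_23 : w \oc v = 0.
Proof. exact: dist_comp0 vwu. Qed.

Lemma dist_comp0_31 : fmap sh u \oc w = 0.
Proof. by apply: oppr_inj; rewrite oppr0 -compNm (dist_comp0 wuv). Qed.

Lemma dist_lift3 Z (g : hom Z E) : w \oc g = 0 -> exists h, g = v \oc h.
Proof. by move=> wg; apply: (dist_lift vwu). Qed.

Lemma dist_extend3 Z (g : hom E Z) : g \oc v = 0 -> exists h, g = h \oc w.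
Proof. by move=> gv; apply: (dist_extend vwu). Qed.

Lemma dist_lift_shift Z (g : hom Z (sh A)) :
  fmap sh u \oc g = 0 -> exists h, g = w \oc h.
Proof. by move=> ug; apply: (dist_lift wuv); rewrite compNm ug oppr0. Qed.

(** The map [w] vanishes, being [r[1] u[1] w]; the section [j] comes from extending [1 - u r] along
    [v]. *)
Lemma dist_retraction (r : hom D A) : r \oc u = idm A ->
  exists j : hom E D, v \oc j = idm E /\ j \oc v = idm D - u \oc r.
Proof.
move=> ru; have w0 : w = 0.
  by rewrite -[w]comp1m -fmap_id -ru fmap_comp -compA dist_comp0_31 compm0.
have [|j jE] := dist_extend (uvw) (g := idm D - u \oc r).
  by rewrite compBl comp1m -compA ru compm1 subrr.
exists j; split=> //.
(* The defect [v j - 1] vanishes on [v], hence factors through [w = 0]. *)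
have [|s sE] := dist_extend3 (g := v \oc j - idm E).
  rewrite compBl -compA -jE compBr compm1 compA (dist_comp0 uvw) comp0m subr0.
  by rewrite comp1m subrr.
by apply/eqP; rewrite -subr_eq0 sE w0 compm0.
Qed.

Lemma dist_unrotate : exists (x : hom (unshift (tri_shift B) E) A)
  (y : hom D (sh (unshift (tri_shift B) E))), dist x u y.
Proof.
have [e eV] := shift_counit_iso (tri_shift B) E.
have [eK Ke] := eV.
have [x xE] := shift_full (w \oc shift_counit (tri_shift B) E).
(* Rotation introduces a sign, which the choice of [- x] absorbs. *)
exists (- x), (e \oc v); apply/dist_rotate; rewrite fmapN opprK -xE.
apply: (dist_iso (is_iso_id A) (is_iso_id D) (inverse_is_iso eV) _ _ _ uvw).
- by rewrite comp1m compm1.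
- by rewrite compm1.
by rewrite fmap_id comp1m -compA Ke compm1.
Qed.

End RotatedExactness.

Lemma cocone_exists A D (p : hom A D) :
  exists K (x : hom K A) (z : hom D (sh K)), dist x p z.
Proof.
by have [E [v [w t]]] := dist_exists p; have [x [y t']] := dist_unrotate t;
  exists (unshift (tri_shift B) E), x, y.
Qed.

(** A retract is a direct summand here, with the cone of [i] as complement. *)
Lemma summand_closed_retract (P : B -> Prop) A S (i : hom A S) (r : hom S A) :
  summand_closed P -> r \oc i = idm A -> P S -> P A.
Proof.
move=> sumP ri; have [K [q [d t]]] := dist_exists i.
have [j [qj jq]] := dist_retraction t ri.
apply: sumP; exists i, j, r, q; split=> //.
- exact: dist_comp0 t.
- rewrite -[r \oc j]compm1 -qj compA -(compA r) jq compBr compm1 compA ri.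
  by rewrite comp1m subrr comp0m.
by rewrite jq addrC subrK.
Qed.

End Triangulated.

(** * Model structures *)

Section ModelStructures.

Variables (C : preadditive_category) (M : model_structure C).
Implicit Types A B D E : C.

Definition has_lift A B D E (i : hom A B) (p : hom D E) : Prop :=
  forall (a : hom A D) (b : hom B E), p \oc a = b \oc i ->
    exists h : hom B D, h \oc i = a /\ p \oc h = b.

Let HM := model_is_model M.

(** The retract argument: a lift in the square with top [j] and bottom [idm B] makes [f] a retract
    of [j]. *)
Lemma retract_of_right_factor A B E (f : hom A B) (j : hom A E) (p : hom E B) :
  f = p \oc j -> has_lift f p -> is_retract f j.
Proof.
move=> fE lift_f; have [|h [hf ph]] := lift_f j (idm B); first by rewrite comp1m.
by exists (idm A), (idm A), h, p; split; rewrite ?comp1m ?compm1.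
Qed.

Lemma retract_of_left_factor A B E (f : hom A B) (j : hom A E) (p : hom E B) :
  f = p \oc j -> has_lift j f -> is_retract f p.
Proof.
move=> fE lift_f; have [|h [hf ph]] := lift_f (idm A) p; first by rewrite compm1.
by exists j, h, (idm B), (idm B); split; rewrite ?comp1m ?compm1.
Qed.

(** The retract argument, applied to a suitable factorization of [f], gives this characterization
    and the three that follow. *)
Lemma cofib_lift A B (f : hom A B) :
  Cofib M f <->
  (forall D E (p : hom D E), Fib M p -> Weq M p -> has_lift f p).
Proof.
split=> [cf D E p fp wp a b | lift_f]; first exact: (model_cofib_lift HM).
have [E [j [p [cj [fp wp] fE]]]] := model_cofib_trivfib HM f.
apply: (model_cofib_retract HM) cj; apply: retract_of_right_factor fE _.
exact: lift_f.
Qed.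

Lemma trivcofib_lift A B (f : hom A B) :
  Cofib M f /\ Weq M f <->
  (forall D E (p : hom D E), Fib M p -> has_lift f p).
Proof.
split=> [[cf wf] D E p fp a b | lift_f]; first exact: (model_fib_lift HM).
have [E [j [p [[cj wj] fp fE]]]] := model_trivcofib_fib HM f.
have fj := retract_of_right_factor fE (lift_f _ _ _ fp).
by split; [apply: (model_cofib_retract HM) cj | apply: (model_weq_retract HM) wj].
Qed.

Lemma fib_lift A B (f : hom A B) :
  Fib M f <->
  (forall D E (i : hom D E), Cofib M i -> Weq M i -> has_lift i f).
Proof.
split=> [ff D E i ci wi a b | lift_f]; first exact: (model_fib_lift HM).
have [E [j [p [[cj wj] fp fE]]]] := model_trivcofib_fib HM f.
apply: (model_fib_retract HM) fp; apply: retract_of_left_factor fE _.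
exact: lift_f.
Qed.

Lemma trivfib_lift A B (f : hom A B) :
  Fib M f /\ Weq M f <->
  (forall D E (i : hom D E), Cofib M i -> has_lift i f).
Proof.
split=> [[ff wf] D E i ci a b | lift_f]; first exact: (model_cofib_lift HM).
have [E [j [p [cj [fp wp] fE]]]] := model_cofib_trivfib HM f.
have fj := retract_of_left_factor fE (lift_f _ _ _ cj).
by split; [apply: (model_fib_retract HM) fp | apply: (model_weq_retract HM) wp].
Qed.

Lemma weq_id A : Weq M (idm A).
Proof.
by have [] : Cofib M (idm A) /\ Weq M (idm A)
  by apply/trivcofib_lift=> D E p _ a b e; exists a; rewrite compm1 e compm1.
Qed.

(** Factor [f] as a trivial cofibration and a fibration; two-out-of-three makes the fibration
    trivial. *)
Lemma weq_trivcofib_trivfib A B (f : hom A B) :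
  Weq M f <-> exists E (i : hom A E) (p : hom E B),
    [/\ Cofib M i /\ Weq M i, Fib M p /\ Weq M p & f = p \oc i].
Proof.
split=> [wf | [E [i [p [[_ wi] [_ wp] ->]]]]].
  have [E [i [p [[ci wi] fp fE]]]] := model_trivcofib_fib HM f.
  have [_ h _] := model_two_out_of_three HM i p.
  by exists E, i, p; split=> //; split=> //; apply: h; rewrite // -fE.
by have [h _ _] := model_two_out_of_three HM i p; apply: h.
Qed.

End ModelStructures.

(** Lifting determines the trivial cofibrations and the trivial fibrations, and their composites are
    the weak equivalences. *)
Lemma model_structure_ext (C : preadditive_category) (M N : model_structure C) :
  (forall A B (f : hom A B), Cofib M f <-> Cofib N f) ->
  (forall A B (f : hom A B), Fib M f <-> Fib N f) -> M = N.
Proof.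
move=> eqC eqF.
have eqTC A B (f : hom A B) : Cofib M f /\ Weq M f <-> Cofib N f /\ Weq N f.
  by rewrite !trivcofib_lift; split=> l D E p /eqF; apply: l.
have eqTF A B (f : hom A B) : Fib M f /\ Weq M f <-> Fib N f /\ Weq N f.
  by rewrite !trivfib_lift; split=> l D E p /eqC; apply: l.
have eqW A B (f : hom A B) : Weq M f <-> Weq N f.
  by rewrite !weq_trivcofib_trivfib; split=> -[E [i [p [/eqTC ? /eqTF ? ?]]]];
    exists E, i, p.
case: M N eqC eqF eqW {eqTC eqTF} => cM fM wM HM [cN fN wN HN] /= eqC eqF eqW.
have eC : cM = cN.
  by apply: functional_extensionality_dep => A;
    apply: functional_extensionality_dep => B; apply/predeqP/eqC.
have eF : fM = fN.
  by apply: functional_extensionality_dep => A;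
    apply: functional_extensionality_dep => B; apply/predeqP/eqF.
have eW : wM = wN.
  by apply: functional_extensionality_dep => A;
    apply: functional_extensionality_dep => B; apply/predeqP/eqW.
by subst; rewrite (Prop_irrelevance HM HN).
Qed.

(** * Cofibrant and trivially fibrant objects via lifting *)

Section ModelObjectsTheory.

Variables (C : additive_category) (M : model_structure C).
Implicit Types A S : C.
Let HM := model_is_model M.

Lemma cofibrant_lift A : cofibrant M A <->
  forall D E (p : hom D E), Fib M p -> Weq M p ->
    forall b : hom A E, exists h, p \oc h = b.
Proof.
rewrite /cofibrant cofib_lift; split=> l D E p fp wp.
  move=> b; have [|h [_ ph]] := l _ _ _ fp wp 0 b; last by exists h.
  by rewrite !compm0.
move=> a b _; have [h ph] := l _ _ _ fp wp b; exists h; split=> //.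
by rewrite (hom_from_zobj a) compm0.
Qed.

Lemma trivial_to_zobj A : trivial M A <-> Weq M (0 : hom A zobj).
Proof.
(* The composite [0 -> A -> 0] is an identity, hence a weak equivalence. *)
have w0 : Weq M ((0 : hom A zobj) \oc (0 : hom zobj A)).
  by rewrite compm0 -zobj_id; apply: weq_id.
by have [_ h h'] := model_two_out_of_three HM (0 : hom zobj A) (0 : hom A zobj);
  split=> w; [apply: h | apply: h'].
Qed.

Lemma trivially_fibrantE A :
  trivially_fibrant M A <-> Fib M (0 : hom A zobj) /\ Weq M (0 : hom A zobj).
Proof. by rewrite /trivially_fibrant trivial_to_zobj; split=> -[]. Qed.

Lemma trivially_fibrant_lift A : trivially_fibrant M A <->
  forall D E (i : hom D E), Cofib M i ->
    forall a : hom D A, exists h, h \oc i = a.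
Proof.
rewrite trivially_fibrantE trivfib_lift; split=> l D E i ci.
  move=> a; have [|h [hi _]] := l _ _ _ ci a 0; last by exists h.
  by rewrite !comp0m.
move=> a b _; have [h hi] := l _ _ _ ci a; exists h; split=> //.
by rewrite (hom_to_zobj b) comp0m.
Qed.

Lemma cofibrant_retract A S (i : hom A S) (r : hom S A) :
  r \oc i = idm A -> cofibrant M S -> cofibrant M A.
Proof.
move=> ri /cofibrant_lift lS; apply/cofibrant_lift=> D E p fp wp b.
have [h ph] := lS _ _ _ fp wp (b \oc r).
by exists (h \oc i); rewrite compA ph -compA ri compm1.
Qed.

Lemma trivially_fibrant_retract A S (i : hom A S) (r : hom S A) :
  r \oc i = idm A -> trivially_fibrant M S -> trivially_fibrant M A.
Proof.
move=> ri /trivially_fibrant_lift lS; apply/trivially_fibrant_lift=> D E j cj a.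
have [h hj] := lS _ _ _ cj (i \oc a).
by exists (r \oc h); rewrite -compA hj compA ri comp1m.
Qed.

Lemma cofibrant_additive : additive_subcategory (cofibrant M).
Proof.
split; first by apply/cofibrant_lift=> D E p _ _ b; exists 0;
  rewrite (hom_from_zobj b) compm0.
move=> A A' S [i1 [i2 [p1 [p2 [_ _ _ _ e]]]]] /cofibrant_lift l1 /cofibrant_lift l2.
apply/cofibrant_lift=> D E p fp wp b.
have [h1 ph1] := l1 _ _ _ fp wp (b \oc i1).
have [h2 ph2] := l2 _ _ _ fp wp (b \oc i2).
by exists (h1 \oc p1 + h2 \oc p2);
  rewrite compDr !compA ph1 ph2 -!compA -compDr e compm1.
Qed.

Lemma trivially_fibrant_additive : additive_subcategory (trivially_fibrant M).
Proof.
split; first by apply/trivially_fibrant_lift=> D E p _ a; exists 0;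
  rewrite (hom_to_zobj a) comp0m.
move=> A A' S [i1 [i2 [p1 [p2 [_ _ _ _ e]]]]].
move=> /trivially_fibrant_lift l1 /trivially_fibrant_lift l2.
apply/trivially_fibrant_lift=> D E j cj a.
have [h1 h1j] := l1 _ _ _ cj (p1 \oc a).
have [h2 h2j] := l2 _ _ _ cj (p2 \oc a).
by exists (i1 \oc h1 + i2 \oc h2);
  rewrite compDl -!compA h1j h2j !compA -compDl e comp1m.
Qed.

End ModelObjectsTheory.

(** * From weakly projective model structures to co-t-structures *)

Section WeaklyProjective.

Variables (B : triangulated_category) (M : model_structure B).
Hypothesis wpM : weakly_projective M.
Implicit Types A D E K Z : B.

Let HM := model_is_model M.
Let X := cofibrant M.
Let Y := trivially_fibrant M.

Lemma cofib_to_zobj Z : X (sh Z) -> Cofib M (0 : hom Z zobj).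
Proof.
by move=> XZ; apply/wp_cofib=> //; have [w t] := dist_to_zobj Z;
  exists (sh Z), 0, w.
Qed.

(** The map [0 -> A[1]] has cocone [A], so it is a trivial fibration. *)
Lemma trivially_fibrant_shift A : Y A -> Y (sh A).
Proof.
move=> YA; split; last exact: wp_fibrant.
suff [] : Fib M (0 : hom zobj (sh A)) /\ Weq M (0 : hom zobj (sh A)) by [].
by apply/wp_trivfib=> //; have [w t] := dist_to_zobj A; exists A, 0, w.
Qed.

(** As [Z -> 0] is a cofibration, [f] extends along it and so factors through zero. *)
Lemma cofibrant_orthogonal Z A (f : hom Z A) : X (sh Z) -> Y A -> f = 0.
Proof.
move=> /cofib_to_zobj cZ /trivially_fibrant_lift lA.
by have [h <-] := lA _ _ _ cZ f; rewrite compm0.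
Qed.

(** Factor [0 -> Z] through a cofibrant [E] and a trivial fibration with cocone [K]; the connecting
    map [Z -> K[1]] vanishes by orthogonality, so [Z] is a retract of [E]. *)
Lemma cofibrant_unshift Z : X (sh Z) -> X Z.
Proof.
move=> XZ.
have [E [i [p [ci tp _]]]] := model_cofib_trivfib HM (0 : hom zobj Z).
have /(wp_trivfib wpM) [K [x [z [t YK]]]] := tp.
have z0 : z = 0.
  exact: cofibrant_orthogonal XZ (trivially_fibrant_shift YK).
have [|s sE] := dist_lift3 t (g := idm Z); first by rewrite z0 comp0m.
apply: (cofibrant_retract (esym sE)); rewrite /cofibrant.
by rewrite -(hom_from_zobj i).
Qed.

(** Factor [T -> 0] as a cofibration and a trivial fibration: the middle object is trivially
    fibrant, and the triangle on the cofibration is rotated back. *)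
Lemma cofibrant_triangle T : exists Z A (x : hom Z T) (y : hom T A)
  (z : hom A (sh Z)), [/\ dist x y z, X (sh Z) & Y A].
Proof.
have [E [i [p [ci tp _]]]] := model_cofib_trivfib HM (0 : hom T zobj).
have [K [q [d [t XK]]]] := proj1 (wp_cofib wpM i) ci.
have [x [y t']] := dist_unrotate t.
exists (unshift (tri_shift B) K), E, x, i, y; split=> //.
- have [u [v vu]] := iso_is_retract (shift_unshift_isomorphic (tri_shift B) K).
  exact: cofibrant_retract vu XK.
- by apply/trivially_fibrantE; rewrite -(hom_to_zobj p).
Qed.

Lemma cot_axioms_weakly_projective : cot_axioms X Y.
Proof.
have isoX : iso_closed X.
  by move=> A D /iso_sym /iso_is_retract[i [r ri]]; apply: cofibrant_retract ri.
have isoY : iso_closed Y.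
  move=> A D /iso_sym /iso_is_retract[i [r ri]].
  exact: trivially_fibrant_retract ri.
split=> //.
- exact: cofibrant_additive.
- by move=> A A' S /biproduct_is_retract[i [r ri]]; apply: cofibrant_retract ri.
- exact: trivially_fibrant_additive.
- move=> A A' S /biproduct_is_retract[i [r ri]].
  exact: trivially_fibrant_retract ri.
- by move=> A /(image_unshiftP _ _ isoX); apply: cofibrant_unshift.
- move=> A [D [YD /iso_sym AD]]; apply: isoY AD _.
  exact: trivially_fibrant_shift.
- move=> A A' f /(image_unshiftP _ _ isoX); exact: cofibrant_orthogonal.
move=> T; have [Z [A [x [y [z [t XZ YA]]]]]] := cofibrant_triangle T.
by exists Z, A, x, y, z; split=> //; apply/image_unshiftP.
Qed.

(** Factor [0 -> D] as a trivial cofibration and a fibration [t]; maps from the coheart lift along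
    [t] because [0 -> W'] is a trivial cofibration. *)
Lemma coheart_contravariantly_finite :
  contravariantly_finite (fun A => X A /\ Y A).
Proof.
move=> D.
have [W [i [t [[ci wi] ft _]]]] := model_trivcofib_fib HM (0 : hom zobj D).
rewrite (hom_from_zobj i) in ci wi.
exists W, t; split=> [|W' t' [XW' [wW' _]]].
  by split=> //; split=> //; apply: wp_fibrant.
have [|h [_ th]] := proj1 (fib_lift M t) ft _ _ _ XW' wW' 0 t'.
  by rewrite !compm0.
by exists h.
Qed.

(* As every object is fibrant, a trivial cofibration is a split monomorphism;
   it is then the inclusion of a direct summand whose complement, its cone,
   lies in the coheart. *)
Lemma fib_coheart_epic A D (f : hom A D) :
  Fib M f <-> forall W, X W -> Y W -> forall b : hom W D, exists h, f \oc h = b.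
Proof.
split=> [ff W XW [wW _] b | epi_f].
  have [|h [_ fh]] := proj1 (fib_lift M f) ff _ _ _ XW wW 0 b.
    by rewrite !compm0.
  by exists h.
apply/fib_lift=> E F i ci wi a b fabi.
have [K [q [d [t XK]]]] := proj1 (wp_cofib wpM i) ci.
have [|r [ri _]] := proj1 (fib_lift M _) (wp_fibrant wpM E) _ _ _ ci wi (idm E) 0.
  by rewrite !comp0m.
have [j [qj jq]] := dist_retraction t ri.
have wK : trivial M K.
  (* The maps [j] and [q] exhibit [0 -> K] as a retract of [i]. *)
  apply: (model_weq_retract HM) wi; exists 0, 0, j, q; split=> //.
  - by rewrite comp0m zobj_id.
  - by rewrite !compm0.
  - by rewrite (dist_comp0 t) comp0m.
have [l fl] := epi_f K XK (conj wK (wp_fibrant wpM K)) (b \oc j).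
exists (a \oc r + l \oc q); split.
  by rewrite compDl -!compA ri (dist_comp0 t) compm1 compm0 addr0.
rewrite compDr !compA fl fabi -!compA jq -compDr.
by rewrite addrC subrK compm1.
Qed.

End WeaklyProjective.

(** Cofibrations are read off from cones, and fibrations from [fib_coheart_epic]. *)
Lemma weakly_projective_ext (B : triangulated_category)
  (M N : model_structure B) : weakly_projective M -> weakly_projective N ->
  (forall A, cofibrant M A <-> cofibrant N A) ->
  (forall A, trivially_fibrant M A <-> trivially_fibrant N A) -> M = N.
Proof.
move=> wpM wpN eqX eqY; apply: model_structure_ext => A D f.
  rewrite !wp_cofib //; split=> -[K [q [d [t /eqX XK]]]]; by exists K, q, d.
rewrite !fib_coheart_epic //.
by split=> epi_f W /eqX XW /eqY YW; apply: epi_f.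
Qed.

(** * From co-t-structures to weakly projective model structures *)

Section CoTStructure.

Variables (B : triangulated_category) (T : cot_structure B).
Implicit Types A D E K Z W : B.

Let HT := cot_is_cot T.
Let X := cotX T.
Let Y := cotY T.
Let H := coheart T.

(** * Orthogonality in a co-t-structure *)

Lemma cot_hom_eq0 Z A (f : hom Z A) : X (sh Z) -> Y A -> f = 0.
Proof.
by move=> XZ; apply: (cot_orthogonal HT); apply/image_unshiftP => //;
  apply: (cotX_iso HT).
Qed.

Lemma cotX_of_shift Z : X (sh Z) -> X Z.
Proof.
by move=> XZ; apply: (cotX_unshift HT); apply/image_unshiftP => //;
  apply: (cotX_iso HT).
Qed.

Lemma cot_preenvelope_triangle A : exists Z D (x : hom Z A) (y : hom A D)
  (z : hom D (sh Z)), [/\ dist x y z, X (sh Z) & Y D].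
Proof.
have [Z [D [x [y [z [t /(image_unshiftP _ _ (cotX_iso HT)) XZ YD]]]]]] :=
  cot_triangle HT A.
by exists Z, D, x, y, z.
Qed.

(** The triangle decomposing [A[-1]] is rotated twice, and the counit replaces [A[-1][1]] by [A]. *)
Lemma cot_precover_triangle A : exists K E (x : hom K E) (p : hom E A)
  (z : hom A (sh K)), [/\ dist x p z, X E & Y K].
Proof.
have [Z [K [x [y [z [t XZ YK]]]]]] :=
  cot_preenvelope_triangle (unshift (tri_shift B) A).
have eV := shift_counit_iso (tri_shift B) A; have [e [eK Ke]] := eV.
have t' := proj1 (dist_rotate _ _ _) (proj1 (dist_rotate _ _ _) t).
exists K, (sh Z), z, (shift_counit (tri_shift B) A \oc - fmap sh x).
exists (- fmap sh y \oc e); split=> //.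
apply: (dist_iso (is_iso_id K) (is_iso_id (sh Z)) eV _ _ _ t').
- by rewrite comp1m compm1.
- by rewrite compm1.
by rewrite fmap_id comp1m -compA eK compm1.
Qed.

Lemma cot_hom_shift_eq0 A D (f : hom A (sh D)) : X A -> Y D -> f = 0.
Proof.
move=> XA YD; have [e [eK Ke]] := shift_counit_iso (tri_shift B) A.
have [g gE] := shift_full (f \oc shift_counit (tri_shift B) A).
have g0 : g = 0.
  apply: cot_hom_eq0 YD; apply: (cotX_iso HT) XA.
  exact/iso_sym/shift_unshift_isomorphic.
by rewrite -[f]compm1 -Ke compA gE g0 fmap0 comp0m.
Qed.

(** The map [Z -> A] in the decomposing triangle is zero, so [A] is a retract of its part in [Y]. *)
Lemma cotY_of_orthogonal A :
  (forall Z, X (sh Z) -> forall f : hom Z A, f = 0) -> Y A.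
Proof.
move=> A0; have [Z [D [x [y [z [t XZ YD]]]]]] := cot_preenvelope_triangle A.
have [|r rE] := dist_extend t (g := idm A); first by rewrite (A0 _ XZ x) compm0.
exact: summand_closed_retract (cotY_summand HT) (esym rE) YD.
Qed.

Lemma cotX_of_orthogonal A :
  (forall D, Y D -> forall f : hom A (sh D), f = 0) -> X A.
Proof.
move=> A0; have [K [E [x [p [z [t XE YK]]]]]] := cot_precover_triangle A.
have [|i iE] := dist_lift3 t (g := idm A); first by rewrite (A0 _ YK z) comp0m.
exact: summand_closed_retract (cotX_summand HT) (esym iE) XE.
Qed.

(** Conditions read off from the long exact sequence of [Hom(-, K)]; in this form retracts and lifts
    need no choice of cone. *)
Lemma has_cone_in_cotX A D (i : hom A D) : has_cone_in X i <->
  (forall K, Y K -> forall g : hom A K, exists h, h \oc i = g) /\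
  (forall K, Y K -> forall g : hom D (sh K), g \oc i = 0 -> g = 0).
Proof.
split=> [[E [q [d [t XE]]]] | [ext_i inj_i]].
  split=> K YK g; last first.
    move=> gi0; have [h ->] := dist_extend t gi0.
    by rewrite (cot_hom_shift_eq0 h XE YK) comp0m.
  have [x [y tx]] := dist_unrotate t.
  have [|h ->] := dist_extend tx (g := g); last by exists h.
  apply: cot_hom_eq0 YK; apply: (cotX_iso HT) XE.
  exact/iso_sym/shift_unshift_isomorphic.
have [E [q [d t]]] := dist_exists i; exists E, q, d; split=> //.
apply: cotX_of_orthogonal => K YK g.
have gq0 : g \oc q = 0.
  by apply: inj_i => //; rewrite -compA (dist_comp0 t) compm0.
(* The map [g] is [s'[1] d] for some [s' : A -> K]; extending [s'] along [i] makes it vanish, since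
   [i[1] d = 0]. *)
have [s ->] := dist_extend3 t gq0; have [s' ->] := shift_full s.
have [h <-] := ext_i _ YK s'.
by rewrite fmap_comp -compA (dist_comp0_31 t) compm0.
Qed.

Lemma has_cocone_in_cotY A D (p : hom A D) : has_cocone_in Y p <->
  (forall E, X E -> forall g : hom E D, exists h, p \oc h = g) /\
  (forall Z, X (sh Z) -> forall g : hom Z A, p \oc g = 0 -> g = 0).
Proof.
split=> [[K [x [z [t YK]]]] | [lift_p inj_p]].
  split=> [E XE g | Z XZ g pg0].
    have [|h ->] := dist_lift3 t (g := g); last by exists h.
    exact: cot_hom_shift_eq0 XE YK.
  have [h ->] := dist_lift t pg0.
  by rewrite (cot_hom_eq0 h XZ YK) compm0.
have [K [x [z t]]] := cocone_exists p; exists K, x, z; split=> //.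
apply: cotY_of_orthogonal => Z XZ g; apply: (@shift_faithful _ (tri_shift B)).
have xg0 : x \oc g = 0.
  by apply: (inj_p Z XZ); rewrite compA (dist_comp0 t) comp0m.
have [|h ->] := dist_lift_shift t (g := fmap sh g).
  by rewrite -fmap_comp xg0 fmap0.
have [h' <-] := lift_p _ XZ h.
by rewrite compA (dist_comp0_23 t) comp0m.
Qed.

Lemma cotX_extension A D E (u : hom A D) (v : hom D E) (w : hom E (sh A)) :
  dist u v w -> X A -> X E -> X D.
Proof.
move=> t XA XE; apply: cotX_of_orthogonal => K YK g.
have [|h ->] := dist_extend t (g := g); first exact: cot_hom_shift_eq0 XA YK.
by rewrite (cot_hom_shift_eq0 h XE YK) comp0m.
Qed.

(** * Maps factoring through the coheart *)

Definition coheart_null A D (f : hom A D) : Prop :=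
  exists W (u : hom W D) (v : hom A W), H W /\ f = u \oc v.

(** Both maps factor through the biproduct of [W] and [W'], which lies in the coheart. *)
Lemma coheart_null_sub A D (f g : hom A D) :
  coheart_null f -> coheart_null g -> coheart_null (f - g).
Proof.
move=> [W [u [v [[XW YW] ->]]]] [W' [u' [v' [[XW' YW'] ->]]]].
have [S WS] := biproduct_exists W W'.
have [i1 [i2 [p1 [p2 [p1i1 p2i2 p2i1 p1i2 _]]]]] := WS.
exists S, (u \oc p1 - u' \oc p2), (i1 \oc v + i2 \oc v'); split.
  split; first exact: (proj2 (cotX_additive HT)) WS XW XW'.
  exact: (proj2 (cotY_additive HT)) WS YW YW'.
rewrite compBl !compDr -!compA !(compA p1) !(compA p2).
by rewrite p1i1 p1i2 p2i1 p2i2 !comp0m !comp1m !compm0 addr0 add0r.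
Qed.

Lemma coheart_null0 A D : coheart_null (0 : hom A D).
Proof.
exists zobj, 0, 0; rewrite compm0; split=> //.
by split; [apply: (proj1 (cotX_additive HT)) | apply: (proj1 (cotY_additive HT))].
Qed.

Lemma coheart_nullN A D (f : hom A D) : coheart_null f -> coheart_null (- f).
Proof.
by rewrite -[- f]sub0r; apply: coheart_null_sub; apply: coheart_null0.
Qed.

Lemma coheart_null_trans A D (g f h : hom A D) :
  coheart_null (f - g) -> coheart_null (g - h) -> coheart_null (f - h).
Proof.
move=> nfg /coheart_nullN ngh.
by rewrite -(subrK g f) -addrA -[g - h]opprK; apply: coheart_null_sub.
Qed.

Lemma coheart_null_compl A D E (g : hom D E) (f : hom A D) :
  coheart_null f -> coheart_null (g \oc f).
Proof. by move=> [W [u [v [HW ->]]]]; exists W, (g \oc u), v; rewrite compA. Qed.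

Lemma coheart_nullP A D (f g : hom A D) :
  coheart_null (f - g) -> coheart_null f -> coheart_null g.
Proof. by move=> nfg nf; rewrite -[g](subKr f); apply: coheart_null_sub. Qed.

(** In the triangle [Z -> A -> W] decomposing [A], orthogonality makes [f] factor through [W]; and
    [W], an extension of [Z[1]] by [A], lies in [X] as well as in [Y]. *)
Lemma coheart_null_XY A D (f : hom A D) : X A -> Y D -> coheart_null f.
Proof.
move=> XA YD; have [Z [W [x [y [z [t XZ YW]]]]]] := cot_preenvelope_triangle A.
have [|h ->] := dist_extend t (g := f); first exact: cot_hom_eq0 XZ YD.
exists W, h, y; split=> //; split=> //.
exact: cotX_extension (proj1 (dist_rotate _ _ _) t) XA XZ.
Qed.

Lemma coheart_null_unshift A D (f : hom A D) : X (sh A) -> coheart_null f -> f = 0.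
Proof.
by move=> XA [W [u [v [[_ YW] ->]]]]; rewrite (cot_hom_eq0 v XA YW) compm0.
Qed.

(** * The three classes of the model structure *)

Definition cot_cofib : morphism_class B := fun A D f => has_cone_in X f.

Definition cot_fib : morphism_class B := fun A D f =>
  forall W, H W -> forall g : hom W D, exists h, f \oc h = g.

(* A weak equivalence is a map inducing bijections, for all [E] in [X], between
   the groups of maps from [E] modulo those factoring through the coheart: these
   are the maps from [E] in the homotopy category. *)
Definition cot_weq : morphism_class B := fun A D f =>
  (forall E, X E -> forall g : hom E D, exists h, coheart_null (g - f \oc h)) /\
  (forall E, X E -> forall g : hom E A, coheart_null (f \oc g) -> coheart_null g).

Lemma cot_weq_two_out_of_three : two_out_of_three cot_weq.
Proof.
move=> A D E f g; split.
- move=> [sf jf] [sg jg]; split=> K XK k.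
    have [h nh] := sg _ XK k; have [h' nh'] := sf _ XK h.
    exists h'; apply: coheart_null_trans nh _; rewrite -compA -compBr.
    exact: coheart_null_compl.
  by rewrite -compA => n; apply: (jf _ XK); apply: (jg _ XK).
- move=> [sf jf] [sgf jgf]; split=> K XK k.
    by have [h nh] := sgf _ XK k; exists (f \oc h); rewrite compA.
  have [h nh] := sf _ XK k => n.
  apply: (@coheart_nullP _ _ (f \oc h)).
    by rewrite -opprB; apply: coheart_nullN.
  apply: coheart_null_compl; apply: (jgf _ XK); rewrite -compA.
  apply: coheart_nullP n; rewrite -compBr; exact: coheart_null_compl.
move=> [sg jg] [sgf jgf]; split=> K XK k.
  have [h nh] := sgf _ XK (g \oc k); exists h; apply: (jg _ XK).
  by rewrite compBr compA.
by move=> n; apply: (jgf _ XK); rewrite -compA; apply: coheart_null_compl.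
Qed.

Lemma cot_weq_retract : retract_closed cot_weq.
Proof.
move=> A D A' D' f g [i [r [j [s [ri sj jf sg]]]]] [sg' jg']; split=> E XE k.
  have [h nh] := sg' _ XE (j \oc k); exists (r \oc h).
  rewrite compA -sg -compA -[k]comp1m -sj -compA -compBr.
  exact: coheart_null_compl.
move=> n; rewrite -[k]comp1m -ri -compA; apply: coheart_null_compl.
apply: (jg' _ XE); rewrite compA -jf -compA; exact: coheart_null_compl.
Qed.

Lemma cot_fib_retract : retract_closed cot_fib.
Proof.
move=> A D A' D' f g [i [r [j [s [ri sj jf sg]]]]] fg W HW k.
have [h gh] := fg W HW (j \oc k).
by exists (r \oc h); rewrite compA -sg -compA gh compA sj comp1m.
Qed.

Lemma cot_cofib_retract : retract_closed cot_cofib.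
Proof.
move=> A D A' D' f g [i [r [j [s [ri sj jf sg]]]]].
move=> /has_cone_in_cotX[ext_g inj_g]; apply/has_cone_in_cotX.
split=> K YK k => [|kf0].
  have [h hg] := ext_g K YK (k \oc r).
  by exists (h \oc j); rewrite -compA jf compA hg -compA ri compm1.
rewrite -[k]compm1 -sj compA [k \oc s](inj_g K YK) ?comp0m //.
by rewrite -compA sg compA kf0 comp0m.
Qed.

(** A fibration lifts the part of a map that factors through the coheart, so surjectivity modulo the
    coheart becomes surjectivity; null maps out of [Z] with [Z[1]] in [X] are zero, which gives
    injectivity. *)
Lemma cot_trivfib_cocone A D (f : hom A D) :
  cot_fib f /\ cot_weq f <-> has_cocone_in Y f.
Proof.
split=> [[ff [sf jf]] | cf].
  apply/has_cocone_in_cotY; split=> [E XE g | Z XZ g fg0].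
    have [h [W [u [v [HW guv]]]]] := sf E XE g.
    have [u' fu'] := ff W HW u; exists (h + u' \oc v).
    by rewrite compDr compA fu' -guv addrC subrK.
  apply: (coheart_null_unshift XZ); apply: (jf Z (cotX_of_shift XZ)).
  by rewrite fg0; apply: coheart_null0.
have [sf _] := proj1 (has_cocone_in_cotY f) cf.
split=> [W [XW _] | ]; first exact: sf.
split=> E XE g => [|[W [u [v [[XW YW] fguv]]]]].
  by have [h <-] := sf E XE g; exists h; rewrite subrr; apply: coheart_null0.
(* With [u] lifted to [u'], the difference [u' v - g] factors through the cocone [K] in [Y], hence
   is null. *)
have [K [x [z [t YK]]]] := cf; have [u' fu'] := sf W XW u.
have [|k kE] := dist_lift t (g := u' \oc v - g).
  by rewrite compBr compA fu' fguv subrr.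
apply: (@coheart_nullP _ _ (u' \oc v)).
  by rewrite kE; apply: coheart_null_compl; apply: coheart_null_XY.
by exists W, u', v.
Qed.

(** The obstruction [z b] to lifting [b] vanishes because it does after composing with [i]; the
    remaining error on [A] factors through [K] and extends along [i]. *)
Lemma cot_cofib_lift : lifts_against cot_cofib (trivial_class cot_fib cot_weq).
Proof.
move=> A D E F i p a b ci /cot_trivfib_cocone [K [k [z [t YK]]]] paib.
have [ext_i inj_i] := proj1 (has_cone_in_cotX i) ci.
have zb0 : z \oc b = 0.
  by apply: (inj_i K YK); rewrite -compA -paib compA (dist_comp0_23 t) comp0m.
have [h hE] := dist_lift3 t zb0.
have [|g gE] := dist_lift t (g := a - h \oc i).
  by rewrite compBr compA -hE paib subrr.
have [g' g'i] := ext_i K YK g; exists (h + k \oc g'); split.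
  by rewrite compDl -compA g'i -gE addrC subrK.
by rewrite compDr compA (dist_comp0 t) comp0m addr0.
Qed.

(* The octahedron on [Z -> K -> A], where [K] is the cocone of [f] and [Z -> K]
   has cone in [Y]: the cone of the composite is the middle object. *)
Lemma cot_cofib_trivfib :
  factorizes_as cot_cofib (trivial_class cot_fib cot_weq).
Proof.
move=> A D f; have [K [k [w tf]]] := cocone_exists f.
have [Z [P [x [y [z [tK XZ YP]]]]]] := cot_preenvelope_triangle K.
have [E [b [d' tE]]] := dist_exists (k \oc x).
(* The octahedron makes [P] the cocone of [g]; the cone of [b] is [Z[1]]. *)
have [g' [g [tg _ _ gb _]]] := dist_octahedron tK tE tf.
exists E, b, g; split=> //.
  exists (sh Z), d', (- fmap sh (k \oc x)); split=> //.
  exact: (proj1 (dist_rotate _ _ _) tE).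
by apply/cot_trivfib_cocone; exists P, g', (fmap sh y \oc w).
Qed.

(** * Trivial cofibrations and fibrations *)

Hypothesis finH : contravariantly_finite H.

(* [f] factors through [A -> A (+) W] followed by [(f, t) : A (+) W -> D], where
   [t : W -> D] is a precover by the coheart. *)
Lemma coheart_factorization A D (f : hom A D) :
  exists E (i : hom A E) (p : hom E D),
    [/\ cot_cofib i /\ cot_weq i, cot_fib p, f = p \oc i &
        forall F G (q : hom F G), cot_fib q -> has_lift i q].
Proof.
have [W [t [[XW YW] tcov]]] := finH D.
have [E [i1 [i2 [p1 [p2 [p1i1 p2i2 p2i1 p1i2 e]]]]]] := biproduct_exists A W.
exists E, i1, (f \oc p1 + t \oc p2); split.
- split.
    apply/has_cone_in_cotX; split=> K YK g => [|gi1].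
      by exists (g \oc p1); rewrite -compA p1i1 compm1.
    rewrite -[g]compm1 -e compDr !compA gi1 comp0m add0r.
    by rewrite (cot_hom_shift_eq0 (g \oc i2) XW YK) comp0m.
  split=> F XF g => [|n].
    (* The difference [g - i1 p1 g] is [i2 p2 g], which factors through [W]. *)
    exists (p1 \oc g), W, i2, (p2 \oc g); split=> //.
    by rewrite -{1}[g]comp1m -e compDl !compA addrAC subrr add0r.
  by rewrite -[g]comp1m -p1i1 -compA; apply: coheart_null_compl.
- move=> W' HW' g; have [s ->] := tcov _ g HW'.
  exists (i2 \oc s); rewrite compDl -!compA (compA p1) p1i2 (compA p2) p2i2.
  by rewrite comp0m compm0 add0r comp1m.
- by rewrite compDl -!compA p1i1 p2i1 compm1 compm0 addr0.
move=> F G q fq a b qa; have [l ql] := fq W (conj XW YW) (b \oc i2).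
exists (a \oc p1 + l \oc p2); split.
  by rewrite compDl -!compA p1i1 p2i1 compm1 compm0 addr0.
by rewrite compDr !compA qa ql -!compA -compDr e compm1.
Qed.

Lemma cot_trivcofib_fib :
  factorizes_as (trivial_class cot_cofib cot_weq) cot_fib.
Proof.
by move=> A D f; have [E [i [p [ci fp fE _]]]] := coheart_factorization f;
  exists E, i, p.
Qed.

(** In the factorization [f = p i] through the coheart, two-out-of-three makes [p] a trivial
    fibration; so [f] is a retract of [i] and inherits its lifts. *)
Lemma cot_trivcofib_lift :
  lifts_against (trivial_class cot_cofib cot_weq) cot_fib.
Proof.
move=> A D F G f q a b [cf wf] fq qabf.
have [E [i [p [[ci wi] fp fE lift_i]]]] := coheart_factorization f.
have wp : cot_weq p.
  have [_ h _] := cot_weq_two_out_of_three i p.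
  by apply: h => //; rewrite -fE.
have [|s [sf ps]] := cot_cofib_lift (a := i) (b := idm D) cf (conj fp wp).
  by rewrite comp1m.
have [|l [li ql]] := lift_i _ _ _ fq a (b \oc p); first by rewrite -compA -fE.
by exists (l \oc s); rewrite -compA sf li compA ql -compA ps compm1.
Qed.

Definition cot_model : model_structure B :=
  ModelStructure (ModelAxioms cot_weq_two_out_of_three cot_cofib_retract
    cot_fib_retract cot_weq_retract cot_cofib_lift cot_trivcofib_lift
    cot_trivcofib_fib cot_cofib_trivfib).

Lemma cot_model_cofibrant A : cofibrant cot_model A <-> X A.
Proof.
split=> [/has_cone_in_cotX[_ inj] | XA].
  apply: cotX_of_orthogonal => D YD f.
  by apply: inj => //; rewrite compm0.
by exists A, (idm A), 0; split=> //; apply: dist_from_zobj.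
Qed.

Lemma cot_model_fibrant A : fibrant cot_model A.
Proof.
by move=> W _ g; exists 0; rewrite (hom_to_zobj g) compm0.
Qed.

(** A weak equivalence [0 -> A] makes all maps from [X] to [A] null, which suffices for
    orthogonality; the converse rests on [coheart_null_XY]. *)
Lemma cot_model_trivially_fibrant A : trivially_fibrant cot_model A <-> Y A.
Proof.
rewrite /trivially_fibrant; split=> [[[sA _] _] | YA].
  apply: cotY_of_orthogonal => Z XZ f.
  have [h] := sA Z (cotX_of_shift XZ) f.
  by rewrite comp0m subr0; apply: coheart_null_unshift.
split; last exact: cot_model_fibrant.
split=> E XE g; last by rewrite (hom_to_zobj g) => _; apply: coheart_null0.
by exists 0; rewrite compm0 subr0; apply: coheart_null_XY.
Qed.

Lemma cot_model_weakly_projective : weakly_projective cot_model.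
Proof.
split=> [A D f | A D f | A]; last exact: cot_model_fibrant.
  by split=> -[E [q [d [t /cot_model_cofibrant XE]]]]; exists E, q, d.
apply: iff_trans (cot_trivfib_cocone f) _.
by split=> -[K [x [z [t /cot_model_trivially_fibrant YK]]]]; exists K, x, z.
Qed.

End CoTStructure.

(** * The bijection *)

Definition cot_of_model (B : triangulated_category) (M : model_structure B)
    (wpM : weakly_projective M) : cot_structure B :=
  CotStructure (cot_axioms_weakly_projective wpM).

Theorem corollary5p9 (B : triangulated_category) :
  exists Phi : {M : model_structure B | weakly_projective M} ->
               {T : cot_structure B | contravariantly_finite (coheart T)},
    bijective Phi /\
    (forall (M : {M : model_structure B | weakly_projective M}) (A : B),
       (cotX (sval (Phi M)) A <-> cofibrant (sval M) A) /\
       (cotY (sval (Phi M)) A <-> trivially_fibrant (sval M) A)).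
Proof.
pose Phi (M : {M : model_structure B | weakly_projective M}) :
    {T : cot_structure B | contravariantly_finite (coheart T)} :=
  exist _ (cot_of_model (proj2_sig M))
    (coheart_contravariantly_finite (proj2_sig M)).
pose Psi (T : {T : cot_structure B | contravariantly_finite (coheart T)}) :
    {M : model_structure B | weakly_projective M} :=
  exist _ (cot_model (proj2_sig T)) (cot_model_weakly_projective (proj2_sig T)).
exists Phi; split=> //; exists Psi => [[M wpM] | [T finT]].
  apply: eq_exist; apply: (weakly_projective_ext _ wpM) => [|A|A].
  - exact: cot_model_weakly_projective.
  - exact: cot_model_cofibrant.
  - exact: cot_model_trivially_fibrant.
apply: eq_exist; rewrite /cot_of_model /=.
(* The proof of the axioms is generalized so that both predicates can be rewritten in its type. *)
move: (cot_axioms_weakly_projective _).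
have -> : cofibrant (cot_model finT) = cotX T.
  by apply/predeqP=> A; apply: cot_model_cofibrant.
have -> : trivially_fibrant (cot_model finT) = cotY T.
  by apply/predeqP=> A; apply: cot_model_trivially_fibrant.
by case: T {finT} => X Y HT HT' /=; rewrite (Prop_irrelevance HT HT').
Qed.
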